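(* Let $k\ge1$ and $1\le l,m\le k$ be integers, and let $c^{(k)}_{l,m}$ be the coefficient of $x^{\underline{l}}y^{\underline{m}}$ in the unique expansion $(xy)^{\underline{k}} = \sum_{l,m=1}^k c^{(k)}_{l,m}\, x^{\underline{l}}\, y^{\underline{m}}$. Then the number of $k$-conjoint ranking tables of size $l\times m$ equals $l!\,m!\,c^{(k)}_{l,m}$.
   Context: $x^{\underline{n}}=x(x-1)\cdots(x-n+1)$ is the falling factorial power. A $k$-conjoint ranking table of size $l\times m$ is an $l\times m$ array of cells in which each of the numbers $1,2,\dots,k$ is placed in exactly one cell, distinct numbers in distinct cells, the remaining cells left blank, such that every row and every column contains at least one number. *)

(* Defs.v *)
From mathcomp Require Import all_boot all_order all_algebra.
From mathcomp Require Import mpoly.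

Set Implicit Arguments.
Unset Strict Implicit.
Unset Printing Implicit Defensive.

Import GRing.Theory.
Local Open Scope ring_scope.

Definition falling (A : comNzRingType) (x : A) (n : nat) : A :=
  \prod_(i < n) (x - i%:R).

Definition Xvar (R : comNzRingType) : {mpoly R[2]} := 'X_(0 : 'I_2).
Definition Yvar (R : comNzRingType) : {mpoly R[2]} := 'X_(1 : 'I_2).

(* Only the values [c i j] with [1 <= i, j <= k] are relevant. *)
Definition is_falling_expansion (R : comNzRingType) (k : nat)
    (c : nat -> nat -> R) : Prop :=
  falling (Xvar R * Yvar R) k =
    \sum_(1 <= i < k.+1) \sum_(1 <= j < k.+1)
      c i j *: (falling (Xvar R) i * falling (Yvar R) j).

(* [None] is a blank cell; the number [v.+1] is represented by [v : 'I_k], so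
   that the numbers [1, ..., k] are indexed by ['I_k]. *)
Definition is_conjoint_table (k l m : nat) (t : 'M[option 'I_k]_(l, m)) : bool :=
  [&& [forall v : 'I_k,
         #|[set p : 'I_l * 'I_m | t p.1 p.2 == Some v]| == 1%N],
      [forall i : 'I_l, exists j : 'I_m, t i j != None]
    & [forall j : 'I_m, exists i : 'I_l, t i j != None]].

Definition conjoint_tables (k l m : nat) : {set 'M[option 'I_k]_(l, m)} :=
  [set t | is_conjoint_table t].

(* Main.v *)
(** [(a b)^_k] is the number of injections from ['I_k] into the [a x b] grid.
    Sorting them by the sets of rows and columns they meet gives
    [(a b)^_k = \sum_(l, m) 'C(a, l) 'C(b, m) T(l, m)] with [T(l, m)] the number
    of conjoint ranking tables, while evaluating the falling factorial
    expansion at [(a, b)] gives the same sum with [l! m! c(l, m)] instead of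
    [T(l, m)]. The binomial transform is injective, so the two families of
    coefficients agree; since [T] does not depend on [c], this also shows that
    [c] is unique. *)

Require Import Defs.
From mathcomp Require Import all_boot all_order all_algebra.
From mathcomp Require Import ring.
From mathcomp Require Import mpoly.

Set Implicit Arguments.
Unset Strict Implicit.
Unset Printing Implicit Defensive.

Import GRing.Theory Num.Theory.
Local Open Scope ring_scope.

(** * Falling factorials in a commutative ring *)

Lemma falling_nat (R : comNzRingType) (a n : nat) :
  falling (a%:R : R) n = (a ^_ n)%:R.
Proof.
rewrite /falling; elim: n => [|n IHn]; first by rewrite big_ord0.
rewrite big_ord_recr /= IHn ffactnSr natrM.
(* Subtraction in [nat] truncates when [a < n], but then [a ^_ n] is already zero. *)
have [le_na|lt_an] := leqP n a; first by rewrite natrB.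
by rewrite ffact_small // !mul0r.
Qed.

Lemma fallingS (R : comNzRingType) (x : R) n :
  falling x n.+1 = falling x n * (x - n%:R).
Proof. by rewrite /falling big_ord_recr. Qed.

Lemma rmorph_falling (A B : comNzRingType) (f : {rmorphism A -> B}) x n :
  f (falling x n) = falling (f x) n.
Proof.
rewrite /falling rmorph_prod; apply: eq_bigr => i _.
by rewrite rmorphB rmorph_nat.
Qed.

(** Write [x * y] as [((x - i) + i) * ((y - j) + j)]: a factor [x - i] or [y - j] raises the
    corresponding index by one. *)
Lemma falling_mulM (A : comNzRingType) (x y : A) i j n :
  falling x i * falling y j * (x * y - n%:R) =
    falling x i.+1 * falling y j.+1 + falling x i.+1 * falling y j *+ j
    + falling x i * falling y j.+1 *+ i
    + falling x i * falling y j *+ (i * j) - falling x i * falling y j *+ n.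
Proof. by rewrite !fallingS; ring. Qed.

(** * Existence of the falling factorial expansion, and its values at natural numbers *)

Section Expansion.
Variable R : comNzRingType.
Implicit Types (p q : {mpoly R[2]}) (N i j : nat).

Definition falling2 i j := falling (Xvar R) i * falling (Yvar R) j.

Definition in_falling_span N p := exists c : nat -> nat -> R,
  p = \sum_(1 <= i < N.+1) \sum_(1 <= j < N.+1) c i j *: falling2 i j.

Lemma in_falling_span0 N : in_falling_span N 0.
Proof.
exists (fun _ _ => 0); rewrite big1 // => i _.
by rewrite big1 // => j _; rewrite scale0r.
Qed.

Lemma in_falling_spanD N p q :
  in_falling_span N p -> in_falling_span N q -> in_falling_span N (p + q).
Proof.
move=> [c ->] [d ->]; exists (fun i j => c i j + d i j).
rewrite -big_split; apply: eq_bigr => i _ /=.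
by rewrite -big_split; apply: eq_bigr => j _; rewrite scalerDl.
Qed.

Lemma in_falling_spanZ N a p :
  in_falling_span N p -> in_falling_span N (a *: p).
Proof.
move=> [c ->]; exists (fun i j => a * c i j).
rewrite scaler_sumr; apply: eq_bigr => i _ /=.
by rewrite scaler_sumr; apply: eq_bigr => j _; rewrite scalerA.
Qed.

Lemma in_falling_span_falling2 N i j :
  (0 < i <= N)%N -> (0 < j <= N)%N -> in_falling_span N (falling2 i j).
Proof.
move=> hi hj; exists (fun i' j' => ((i' == i) && (j' == j))%:R).
rewrite (bigD1_seq i) ?mem_index_iota ?iota_uniq //=.
rewrite (bigD1_seq j) ?mem_index_iota ?iota_uniq //=.
rewrite !eqxx scale1r big1 ?addr0 => [|j' /negPf->]; last by rewrite scale0r.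
rewrite big1 ?addr0 // => i' /negPf->.
by rewrite big1 // => j' _; rewrite scale0r.
Qed.

Lemma falling2_mulXY i j n :
  falling2 i j * (Xvar R * Yvar R - n%:R) =
    falling2 i.+1 j.+1 + j%:R *: falling2 i.+1 j + i%:R *: falling2 i j.+1
    + (i * j)%:R *: falling2 i j + (- n%:R) *: falling2 i j.
Proof. by rewrite scaleNr !scaler_nat /falling2 falling_mulM. Qed.

(** By induction: the new factor [X * Y - k] raises each index by at most one. The induction starts
    at exponent 1, since the empty product 1 is not in a span whose indices are positive. *)
Lemma falling_XY_in_span k :
  in_falling_span k.+1 (falling (Xvar R * Yvar R) k.+1).
Proof.
elim: k => [|k [c defXY]].
  suff -> : falling (Xvar R * Yvar R) 1 = falling2 1 1.
    exact: in_falling_span_falling2.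
  by rewrite /falling2 /falling !big_ord1 !subr0.
rewrite fallingS defXY mulr_suml big_nat.
apply: big_ind => [|p q|i /andP[i0 lei]];
  [exact: in_falling_span0 | exact: in_falling_spanD |].
rewrite mulr_suml big_nat.
apply: big_ind => [|p q|j /andP[j0 lej]];
  [exact: in_falling_span0 | exact: in_falling_spanD |].
rewrite -scalerAl falling2_mulXY; apply: in_falling_spanZ.
have [lei' lej'] := (ltnW lei, ltnW lej).
do !apply: in_falling_spanD;
  try apply: in_falling_spanZ; apply: in_falling_span_falling2;
  by apply/andP.
Qed.

Lemma is_falling_expansion_eval k (c : nat -> nat -> R) a b :
  is_falling_expansion k c ->
  ((a * b) ^_ k)%:R =
    \sum_(1 <= i < k.+1) (\sum_(1 <= j < k.+1)
      (i`!)%:R * (j`!)%:R * c i j * 'C(b, j)%:R) * 'C(a, i)%:R.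
Proof.
pose v (i : 'I_2) : R := if i == 0 then a%:R else b%:R.
move/(congr1 (meval v)).
rewrite rmorph_falling rmorphM /= !mevalXU /v /= -natrM falling_nat => ->.
rewrite rmorph_sum; apply: eq_bigr => i _.
rewrite rmorph_sum mulr_suml; apply: eq_bigr => j _ /=.
rewrite mevalZ rmorphM !rmorph_falling /= !mevalXU /= !falling_nat.
by rewrite -!bin_ffact !natrM; ring.
Qed.

End Expansion.

(** * Injectivity of the binomial transform in one and two variables *)

Section BinomialTransform.
Variable R : pzRingType.

(** The matrix of the ['C(a, i)] is triangular with unit diagonal: at [a = l] the terms above [l]
    vanish, those below agree by induction, and no division is required. *)
Lemma binomial_transform_inj n (f g : nat -> R) :
    (forall a, \sum_(1 <= i < n.+1) f i * 'C(a, i)%:R =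
               \sum_(1 <= i < n.+1) g i * 'C(a, i)%:R) ->
  forall i, (1 <= i <= n)%N -> f i = g i.
Proof.
move=> eq_fg; elim/ltn_ind => l IHl l_n; have := eq_fg l.
have l_in : l \in index_iota 1 n.+1 by rewrite mem_index_iota.
rewrite !(bigD1_seq l) ?iota_uniq //= binn !mulr1.
suff -> : \sum_(1 <= i < n.+1 | i != l) f i * 'C(l, i)%:R =
          \sum_(1 <= i < n.+1 | i != l) g i * 'C(l, i)%:R by move/addIr.
rewrite big_nat_cond [RHS]big_nat_cond.
apply: eq_bigr => i /andP[i_n ne_il].
case: (ltngtP i l) ne_il => // [lt_il|lt_li] _; first by rewrite IHl.
by rewrite bin_small // !mulr0.
Qed.

(** For fixed [b], injectivity in [a] equates the inner sums; injectivity in [b] then equates the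
    coefficients. *)
Lemma binomial_transform2_inj n (f g : nat -> nat -> R) :
    (forall a b,
      \sum_(1 <= i < n.+1)
         (\sum_(1 <= j < n.+1) f i j * 'C(b, j)%:R) * 'C(a, i)%:R =
      \sum_(1 <= i < n.+1)
         (\sum_(1 <= j < n.+1) g i j * 'C(b, j)%:R) * 'C(a, i)%:R) ->
  forall i j, (1 <= i <= n)%N -> (1 <= j <= n)%N -> f i j = g i j.
Proof.
move=> eq_fg i j i_n; apply: (binomial_transform_inj (f := f i) (g := g i)) => b.
move: i i_n; apply: binomial_transform_inj => a; exact: eq_fg.
Qed.

End BinomialTransform.

(** * Counting injections into a grid by the rows and columns they meet *)

Section Counting.
Variable k : nat.
Local Open Scope nat_scope.

Definition rows_of (S T : finType) (f : {ffun 'I_k -> S * T}) : {set S} :=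
  [set (f v).1 | v : 'I_k].
Definition cols_of (S T : finType) (f : {ffun 'I_k -> S * T}) : {set T} :=
  [set (f v).2 | v : 'I_k].

Definition placements (S T : finType) (A : {set S}) (B : {set T}) :=
  [set f : {ffun 'I_k -> S * T} |
    [&& injectiveb f, rows_of f == A & cols_of f == B]].

(** Passes from the cell of each number to the content of each cell; the choice made by [pick] is
    unambiguous when [f] is injective. *)
Definition table_of l m (f : {ffun 'I_k -> 'I_l * 'I_m}) :
    'M[option 'I_k]_(l, m) :=
  \matrix_(i, j) [pick v | f v == (i, j)].

Lemma table_ofP l m (f : {ffun 'I_k -> 'I_l * 'I_m}) i j v :
  injective f -> (table_of f i j == Some v) = (f v == (i, j)).
Proof.
move=> inj_f; rewrite mxE; case: pickP => [w /eqP fw|no_v]; last by rewrite no_v.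
by rewrite -fw (inj_eq inj_f) eq_sym; apply/eqP/eqP => [[]|->].
Qed.

Lemma conjoint_tablesE l m :
  conjoint_tables k l m = @table_of l m @: placements [set: 'I_l] [set: 'I_m].
Proof.
apply/setP=> t; rewrite inE; apply/idP/imsetP => [|[f]].
  case/and3P=> /forallP t_one /forallP t_row /forallP t_col.
  (* Each number occupies exactly one cell, so these cells form a function of the number. *)
  have [v|f0 f0P] := @fin_all_exists _ _ (fun v p =>
    [set p : 'I_l * 'I_m | t p.1 p.2 == Some v] = [set p]) _.
    exact/cards1P/t_one.
  pose f := finfun f0.
  have fP i j v : (t i j == Some v) = (f v == (i, j)).
    rewrite ffunE [_ == (i, j)]eq_sym.
    by move/setP/(_ (i, j)): (f0P v); rewrite !inE.
  have inj_f : injective f.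
    (* Two numbers sent to the same cell are both its content, hence equal. *)
    move=> v w eq_vw; have := fP (f v).1 (f v).2 v.
    have := fP (f v).1 (f v).2 w; rewrite -surjective_pairing eq_vw eqxx.
    by move=> /eqP-> /eqP[].
  exists f; last first.
    apply/matrixP=> i j; case E: (t i j) => [v|].
      by apply/esym/eqP; rewrite table_ofP // -fP E.
    case E': (table_of f i j) => [v|] //.
    by move/eqP: E'; rewrite table_ofP // -fP E.
  rewrite inE; apply/and3P; split; first exact/injectiveP.
    apply/eqP/setP=> i; rewrite inE; apply/imsetP.
    have /existsP[j] := t_row i; case E: (t i j) => [v|] // _.
    by move/eqP: E; rewrite fP => /eqP fv; exists v; rewrite ?fv.
  apply/eqP/setP=> j; rewrite inE; apply/imsetP.
  have /existsP[i] := t_col j; case E: (t i j) => [v|] // _.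
  by move/eqP: E; rewrite fP => /eqP fv; exists v; rewrite ?fv.
rewrite inE => /and3P[/injectiveP inj_f /eqP rowsT /eqP colsT] ->.
apply/and3P; split; apply/forallP.
- move=> v; apply/cards1P; exists (f v); apply/setP=> -[i j].
  by rewrite !inE table_ofP // eq_sym.
- move=> i; have: i \in rows_of f by rewrite rowsT.
  case/imsetP=> v _ ->; apply/existsP; exists (f v).2.
  have /eqP-> // : table_of f (f v).1 (f v).2 == Some v.
  by rewrite table_ofP // -surjective_pairing.
- move=> j; have: j \in cols_of f by rewrite colsT.
  case/imsetP=> v _ ->; apply/existsP; exists (f v).1.
  have /eqP-> // : table_of f (f v).1 (f v).2 == Some v.
  by rewrite table_ofP // -surjective_pairing.
Qed.

Lemma card_conjoint_tables l m :
  #|conjoint_tables k l m| = #|placements [set: 'I_l] [set: 'I_m]|.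
Proof.
rewrite conjoint_tablesE card_in_imset // => f g.
rewrite !inE => /andP[/injectiveP inj_f _] /andP[/injectiveP inj_g _] eq_fg.
apply/ffunP=> v; apply/esym/eqP; rewrite [f v]surjective_pairing.
by rewrite -table_ofP // -eq_fg table_ofP // -surjective_pairing.
Qed.

(** Numbering the elements of [A] and [B] by [enum_val] identifies the subgrid they span with a
    standard grid, and a placement meeting exactly [A] and [B] stays inside that subgrid. *)
Lemma card_placements (S T : finType) (A : {set S}) (B : {set T}) :
  #|placements A B| = #|conjoint_tables k #|A| #|B| |.
Proof.
rewrite card_conjoint_tables.
pose h (p : 'I_#|A| * 'I_#|B|) : S * T := (enum_val p.1, enum_val p.2).
have inj_h : injective h.
  by move=> [i j] [i' j'] [/enum_val_inj-> /enum_val_inj->].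
pose F (g : {ffun 'I_k -> 'I_#|A| * 'I_#|B|}) := [ffun v => h (g v)].
have inj_F : injective F.
  by move=> g g' /ffunP eqF; apply/ffunP=> v; have := eqF v;
     rewrite !ffunE => /inj_h.
rewrite -(card_imset _ inj_F); apply: eq_card => f.
rewrite inE; apply/idP/imsetP => [/and3P[/injectiveP inj_f /eqP fA /eqP fB]|].
  have fvA v : (f v).1 \in A.
    by rewrite -fA; apply: (imset_f (fun v => (f v).1)).
  have fvB v : (f v).2 \in B.
    by rewrite -fB; apply: (imset_f (fun v => (f v).2)).
  pose g := [ffun v => (enum_rank_in (fvA v) (f v).1,
                        enum_rank_in (fvB v) (f v).2)].
  have hg v : h (g v) = f v.
    by rewrite ffunE /h /= !enum_rankK_in // -surjective_pairing.
  exists g; last by apply/ffunP=> v; rewrite ffunE hg.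
  rewrite inE; apply/and3P; split.
  - by apply/injectiveP=> v w /(congr1 h); rewrite !hg => /inj_f.
  - apply/eqP/setP=> i; rewrite inE; apply/imsetP.
    have: enum_val i \in rows_of f by rewrite fA enum_valP.
    by case/imsetP=> v _; rewrite -hg => /enum_val_inj->; exists v.
  - apply/eqP/setP=> j; rewrite inE; apply/imsetP.
    have: enum_val j \in cols_of f by rewrite fB enum_valP.
    by case/imsetP=> v _; rewrite -hg => /enum_val_inj->; exists v.
case=> g; rewrite inE => /and3P[/injectiveP inj_g /eqP gA /eqP gB] ->.
apply/and3P; split.
- by apply/injectiveP=> v w; rewrite !ffunE => /inj_h/inj_g.
- apply/eqP/setP=> x; apply/imsetP/idP => [[v _ ->]|xA].
    by rewrite ffunE enum_valP.
  have: enum_rank_in xA x \in rows_of g by rewrite gA in_setT.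
  case/imsetP=> v _ def_v; exists v => //.
  by rewrite ffunE /= -def_v enum_rankK_in.
- apply/eqP/setP=> x; apply/imsetP/idP => [[v _ ->]|xB].
    by rewrite ffunE enum_valP.
  have: enum_rank_in xB x \in cols_of g by rewrite gB in_setT.
  case/imsetP=> v _ def_v; exists v => //.
  by rewrite ffunE /= -def_v enum_rankK_in.
Qed.

Lemma sum_by_nat_index (I : finType) (P : pred I) (r F : I -> nat) :
    (forall i, P i -> 0 < r i <= k) ->
  \sum_(i | P i) F i = \sum_(1 <= l < k.+1) \sum_(i | P i && (r i == l)) F i.
Proof.
move=> rP; under [RHS]eq_bigr do rewrite big_mkcondr.
rewrite exchange_big; apply: eq_bigr => i Pi /=.
rewrite (bigD1_seq (r i)) ?mem_index_iota ?iota_uniq ?rP //= eqxx.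
by rewrite big1 ?addn0 // => l /negPf; rewrite eq_sym => ->.
Qed.

(** The injections are split by the exact pair of row set and column set; the binomials count the
    pairs, and every pair contributes the same number. *)
Lemma card_placements_by_size (S T : finType) l m :
  #|[set f : {ffun 'I_k -> S * T} |
      [&& injectiveb f, #|rows_of f| == l & #|cols_of f| == m]]| =
  'C(#|S|, l) * 'C(#|T|, m) * #|conjoint_tables k l m|.
Proof.
pose D := setX [set A : {set S} | #|A| == l] [set B : {set T} | #|B| == m].
have <- : #|D| = 'C(#|S|, l) * 'C(#|T|, m) by rewrite cardsX !card_draws.
rewrite -sum_nat_const -sum1_card.
rewrite (partition_big (fun f => (rows_of f, cols_of f)) (mem D)) => [|f];
  last first.
  by rewrite !inE => /and3P[_ -> ->].
apply: eq_bigr => -[A B]; rewrite !inE /= => /andP[/eqP cA /eqP cB].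
rewrite -cA -cB -card_placements -[RHS]sum1_card; apply: eq_bigl => f.
rewrite !inE xpair_eqE.
by have [->|_] := eqVneq (rows_of f) A; have [->|_] := eqVneq (cols_of f) B;
  rewrite ?cA ?cB ?eqxx ?andbT ?andbF.
Qed.

Lemma ffact_mul_conjoint_tables a b : 0 < k ->
  (a * b) ^_ k =
    \sum_(1 <= l < k.+1)
      (\sum_(1 <= m < k.+1) #|conjoint_tables k l m| * 'C(b, m)) * 'C(a, l).
Proof.
move=> k_gt0.
(* As [k] is positive, an injection meets at least one row and one column, and at most [k] of each,
   so the ranges from 1 to [k] miss nothing. *)
have img_bound (U : finType) (h : 'I_k -> U) : 0 < #|[set h v | v : 'I_k]| <= k.
  rewrite card_gt0 -[X in _ <= X]card_ord leq_imset_card andbT.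
  by apply/set0Pn; exists (h (Ordinal k_gt0)); apply: imset_f.
rewrite -[a in LHS]card_ord -[b in LHS]card_ord -card_prod.
rewrite -[k in LHS]card_ord -card_inj_ffuns -sum1_card.
rewrite (@sum_by_nat_index _ _ (fun f => #|rows_of f|)) => [|f _];
  last exact: img_bound.
apply: eq_bigr => l _; rewrite big_distrl.
rewrite (@sum_by_nat_index _ _ (fun f => #|cols_of f|)) => [|f _];
  last exact: img_bound.
apply: eq_bigr => m _ /=.
have := card_placements_by_size 'I_a 'I_b l m; rewrite !card_ord => cardE.
transitivity ('C(a, l) * 'C(b, m) * #|conjoint_tables k l m|); last first.
  by rewrite mulnC mulnA mulnAC.
rewrite -cardE -sum1_card; apply: eq_bigl => f.
by rewrite !inE andbA.
Qed.

End Counting.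

Theorem theorem2 (R : numDomainType) (k : nat) (hk : (1 <= k)%N) :
  exists c : nat -> nat -> R,
    [/\ is_falling_expansion k c,
        forall c' : nat -> nat -> R, is_falling_expansion k c' ->
          forall l m : nat, (1 <= l <= k)%N -> (1 <= m <= k)%N ->
            c' l m = c l m
      & forall l m : nat, (1 <= l <= k)%N -> (1 <= m <= k)%N ->
          #|conjoint_tables k l m|%:R = (l`!)%:R * (m`!)%:R * c l m].
Proof.
(* Stated for an arbitrary expansion, so that it yields both the count and uniqueness. *)
have tablesE (c : nat -> nat -> R) : is_falling_expansion k c ->
    forall l m : nat, (1 <= l <= k)%N -> (1 <= m <= k)%N ->
    #|conjoint_tables k l m|%:R = (l`!)%:R * (m`!)%:R * c l m.
  move=> expc.
  apply: (@binomial_transform2_inj _ _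
    (fun l m => #|conjoint_tables k l m|%:R)
    (fun l m => (l`!)%:R * (m`!)%:R * c l m)) => a b.
  rewrite -(is_falling_expansion_eval a b expc) ffact_mul_conjoint_tables //.
  rewrite natr_sum; apply: eq_bigr => l _; rewrite natrM natr_sum.
  by congr (_ * _); apply: eq_bigr => m _; rewrite natrM.
have [c expc] : in_falling_span k (falling (Xvar R * Yvar R) k).
  by case: k hk {tablesE} => // n _; apply: falling_XY_in_span.
exists c; split=> //; last exact: tablesE.
move=> c' expc' l m hl hm.
(* A [numDomainType] has characteristic zero and no zero divisors, so the factorials can be
   cancelled. *)
have fact_neq0 n : (n`!)%:R != 0 :> R by rewrite pnatr_eq0 -lt0n fact_gt0.
apply: (mulfI (mulf_neq0 (fact_neq0 l) (fact_neq0 m))).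
by rewrite -!tablesE.
Qed.
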